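(* Let $p\ge 0$ and $q\ge 1$ be fixed polynomial degrees and let $f\in L^2(\Omega)$. Let $(\boldsymbol\sigma_{\mathrm{LS}},u_{\mathrm{LS}})\in(\boldsymbol{RTN}_p(\mathcal{T})\cap\boldsymbol H(\mathrm{div},\Omega))\times(\mathcal{P}_q(\mathcal{T})\cap H^1_0(\Omega))$ be the least-squares mixed finite element solution, i.e. $$(\boldsymbol\sigma_{\mathrm{LS}}+\nabla u_{\mathrm{LS}},\nabla v_{\mathcal{T}})=0\qquad\forall v_{\mathcal{T}}\in\mathcal{P}_q(\mathcal{T})\cap H^1_0(\Omega),$$ $$h_\Omega^2(\nabla\cdot\boldsymbol\sigma_{\mathrm{LS}},\nabla\cdot\boldsymbol p_{\mathcal{T}})+(\boldsymbol\sigma_{\mathrm{LS}}+\nabla u_{\mathrm{LS}},\boldsymbol p_{\mathcal{T}})=h_\Omega^2(f,\nabla\cdot\boldsymbol p_{\mathcal{T}})\qquad\forall\boldsymbol p_{\mathcal{T}}\in\boldsymbol{RTN}_p(\mathcal{T})\cap\boldsymbol H(\mathrm{div},\Omega),$$ approximating the solution $(\boldsymbol\sigma,u)\in\boldsymbol H(\mathrm{div},\Omega)\times H^1_0(\Omega)$ of $$(\boldsymbol\sigma+\nabla u,\nabla v)=0\qquad\forall v\in H^1_0(\Omega),$$ $$h_\Omega^2(\nabla\cdot\boldsymbol\sigma,\nabla\cdot\boldsymbol p)+(\boldsymbol\sigma+\nabla u,\boldsymbol p)=h_\Omega^2(f,\nabla\cdot\boldsymbol p)\qquad\forall\boldsymbol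 p\in\boldsymbol H(\mathrm{div},\Omega).$$ Then $$h_\Omega^2\|\nabla\cdot(\boldsymbol\sigma-\boldsymbol\sigma_{\mathrm{LS}})\|^2\le h_\Omega^2\|\nabla\cdot\boldsymbol\sigma-\Pi^p_{\mathcal{T}}(\nabla\cdot\boldsymbol\sigma)\|^2+\|\nabla(u-u_{\mathrm{LS}})\|^2+\min_{\substack{\boldsymbol v_{\mathcal T}\in\boldsymbol{RTN}_p(\mathcal{T})\cap\boldsymbol H(\mathrm{div},\Omega)\\ \nabla\cdot\boldsymbol v_{\mathcal T}=\Pi^p_{\mathcal{T}}(\nabla\cdot\boldsymbol\sigma)}}\|\boldsymbol\sigma-\boldsymbol v_{\mathcal T}\|^2.$$
   Context: $\Omega\subset\mathbb{R}^d$, $d\in\{2,3\}$, is an open, bounded, connected polygon or polyhedron with Lipschitz boundary; $h_\Omega$ is its diameter. $\mathcal{T}$ is a conforming simplicial, possibly locally refined, mesh of $\Omega$: $\overline\Omega=\bigcup_{K\in\mathcal{T}}K$, each $K$ a closed simplex, and two different simplices intersect in the empty set or a common vertex, edge, or face. $(\cdot,\cdot)$ and $\|\cdot\|$ are the $L^2(\Omega)$ inner product and norm (scalar or vector valued). $\boldsymbol H(\mathrm{div},\Omega):=\{\boldsymbol v\in L^2(\Omega;\mathbb{R}^d):\nabla\cdot\boldsymbol v\in L^2(\Omega)\}$; no boundary condition is imposed on fluxes (the case $\Gamma_{\mathrm N}=\emptyset$). $\mathcal{P}_m(K)$: polynomials of total degree at most $m$ on $K$; $\mathcal{P}_m(\mathcal{T})$: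 functions in $L^2(\Omega)$ whose restriction to each $K\in\mathcal{T}$ is in $\mathcal{P}_m(K)$; $\boldsymbol{RTN}_p(K):=\mathcal{P}_p(K;\mathbb{R}^d)+\boldsymbol x\,\mathcal{P}_p(K)$; $\boldsymbol{RTN}_p(\mathcal{T}):=\{\boldsymbol v_{\mathcal T}\in L^2(\Omega;\mathbb{R}^d):\boldsymbol v_{\mathcal T}|_K\in\boldsymbol{RTN}_p(K)\ \forall K\in\mathcal{T}\}$; $\Pi^p_{\mathcal{T}}$ is the $L^2$-orthogonal projection onto $\mathcal{P}_p(\mathcal{T})$. *)

(* Defs.v *)
From HB Require Import structures.
From mathcomp Require Import all_boot all_order all_algebra.
From mathcomp Require Import all_classical all_reals all_analysis.

Set Implicit Arguments.
Unset Strict Implicit.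
Unset Printing Implicit Defensive.

Import Order.TTheory GRing.Theory Num.Theory.
Import numFieldNormedType.Exports.

Local Open Scope classical_set_scope.
Local Open Scope ring_scope.

(* The sigma-algebra generated by the coordinates is the Borel sigma-algebra
   of R^d. *)
Definition rV_display : measure_display -> measure_display.
Proof. exact. Qed.

Section rV_measurable.
Context (R : realType) (d : nat).

Definition rV_coord (i : 'I_d) (x : 'rV[R]_d) : measurableTypeR R := x ord0 i.

Let rV_set0 : g_sigma_preimage rV_coord set0.
Proof. exact: sigma_algebra0. Qed.

Let rV_setC A : g_sigma_preimage rV_coord A -> g_sigma_preimage rV_coord (~` A).
Proof. exact: sigma_algebraC. Qed.

Let rV_bigcup (F : (set 'rV[R]_d)^nat) :
  (forall i, g_sigma_preimage rV_coord (F i)) ->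
  g_sigma_preimage rV_coord (\bigcup_i (F i)).
Proof. exact: sigma_algebra_bigcup. Qed.

HB.instance Definition _ := @isMeasurable.Build
  (rV_display default_measure_display) 'rV[R]_d
  (g_sigma_preimage rV_coord) rV_set0 rV_setC rV_bigcup.

Lemma measurable_rV_coord (i : 'I_d) : measurable_fun [set: 'rV[R]_d] (rV_coord i).
Proof.
move=> _ Y mY; rewrite setTI; apply: sub_sigma_algebra => /=.
rewrite -bigcup_seq/=; exists i => /=; first by rewrite mem_index_enum.
by exists Y => //; rewrite setTI.
Qed.

Lemma measurable_fun_rV d' (T : measurableType d') (f : T -> 'rV[R]_d) :
  (forall i, measurable_fun [set: T] (rV_coord i \o f)) ->
  measurable_fun [set: T] f.
Proof.
move=> mf _ A mA; rewrite setTI.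
suff : (g_sigma_preimage rV_coord `<=` [set B | measurable (f @^-1` B)]).
  by move=> /(_ _ mA).
apply: smallest_sub.
  split => /=.
  - by rewrite preimage_set0; exact: measurable0.
  - by move=> B mB; rewrite setTD preimage_setC; exact: measurableC.
  - by move=> F mF; rewrite preimage_bigcup; exact: bigcup_measurable.
move=> B; rewrite -bigcup_seq/= => -[i _ [C mC <-]] /=.
by rewrite setTI -comp_preimage -[X in measurable X]setTI; exact: mf.
Qed.

End rV_measurable.

Section lebesgue_rV_cons.
Local Open Scope ereal_scope.
Context (R : realType) (d : nat).

Definition rV_cons (xy : measurableTypeR R * 'rV[R]_d) : 'rV[R]_d.+1 :=
  row_mx (const_mx xy.1 : 'rV[R]_1) xy.2.

Definition rV_uncons (x : 'rV[R]_d.+1) : measurableTypeR R * 'rV[R]_d :=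
  (x ord0 ord0, rsubmx (x : 'rV[R]_(1 + d))).

Lemma rV_cons0 xy : rV_cons xy ord0 ord0 = xy.1.
Proof.
transitivity (rV_cons xy ord0 (lshift d ord0 : 'I_(1 + d))).
  by congr (rV_cons _ _ _); exact/val_inj.
by apply: etrans (row_mxEl _ _ _ _) _; rewrite mxE.
Qed.

Lemma rV_consS xy i : rV_cons xy ord0 (lift ord0 i) = xy.2 ord0 i.
Proof.
transitivity (rV_cons xy ord0 (rshift 1 i : 'I_(1 + d))).
  by congr (rV_cons _ _ _); exact/val_inj.
exact: row_mxEr.
Qed.

Lemma rV_consK : cancel rV_cons rV_uncons.
Proof.
move=> [x y]; rewrite /rV_uncons rV_cons0/=; congr pair.
by rewrite /rV_cons row_mxKr.
Qed.

Lemma measurable_rV_cons : measurable_fun setT rV_cons.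
Proof.
apply: measurable_fun_rV => i.
have [->|] := eqVneq i ord0.
  rewrite (_ : _ \o _ = fst); first exact: measurable_fst.
  by apply/funext => xy /=; rewrite /rV_coord rV_cons0.
rewrite eq_sym => /unlift_some[j -> _].
rewrite (_ : _ \o _ = rV_coord j \o snd).
  by apply: measurableT_comp => //; exact: measurable_rV_coord.
by apply/funext => xy /=; rewrite /rV_coord rV_consS.
Qed.

Lemma measurable_rV_uncons : measurable_fun setT rV_uncons.
Proof.
apply: (measurable_fun_pair (measurable_rV_coord ord0)).
apply: measurable_fun_rV => i.
rewrite (_ : _ \o _ = rV_coord (rshift 1 i : 'I_d.+1)).
  exact: measurable_rV_coord.
by apply/funext => x; rewrite /rV_coord/= mxE.
Qed.

Variable m : {sigma_finite_measure set 'rV[R]_d -> \bar R}.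

Definition lebesgue_rV_cons : set 'rV[R]_d.+1 -> \bar R :=
  pushforward (lebesgue_measure \x m) rV_cons.

Let cons0 : lebesgue_rV_cons set0 = 0.
Proof. by rewrite /lebesgue_rV_cons /pushforward preimage_set0 measure0. Qed.

Let cons_ge0 A : 0 <= lebesgue_rV_cons A.
Proof. rewrite /lebesgue_rV_cons /pushforward; exact: measure_ge0. Qed.

Let cons_sigma_additive : semi_sigma_additive lebesgue_rV_cons.
Proof.
have mc := measurable_rV_cons.
move=> F mF tF mUF; rewrite /lebesgue_rV_cons /pushforward preimage_bigcup.
apply: measure_semi_sigma_additive.
- by move=> n; rewrite -[X in measurable X]setTI; exact: mc.
- apply/trivIsetP => /= i j _ _ ij; rewrite -preimage_setI.
  by move/trivIsetP : tF => /(_ _ _ _ _ ij) ->//; rewrite preimage_set0.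
- by rewrite -preimage_bigcup -[X in measurable X]setTI; exact: mc.
Qed.

HB.instance Definition _ := isMeasure.Build _ _ _
  lebesgue_rV_cons cons0 cons_ge0 cons_sigma_additive.

Let cons_sigma_finite : sigma_finite setT lebesgue_rV_cons.
Proof.
pose l1 : {sigma_finite_measure set (measurableTypeR R) -> \bar R} :=
  lebesgue_measure.
have /sigma_finiteP[F [UF ndF Foo]] := sigma_finiteT l1.
have /sigma_finiteP[G [UG ndG Goo]] := sigma_finiteT m.
exists (fun n => rV_uncons @^-1` (F n `*` G n)).
  rewrite -preimage_bigcup -(preimage_setT rV_uncons); congr (_ @^-1` _).
  rewrite -setXTT UF UG; apply/seteqP; split => -[x y] /=.
    move=> [[n _ Fnx] [k _ Gky]]; exists (maxn n k) => //; split.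
    - by move: x Fnx; exact/subsetPset/ndF/leq_maxl.
    - by move: y Gky; exact/subsetPset/ndG/leq_maxr.
  by move=> [n _ []/= ? ?]; split; exists n.
move=> k; have [mFk Fk] := Foo k; have [mGk Gk] := Goo k; split.
  rewrite -[X in measurable X]setTI.
  by apply: measurable_rV_uncons => //; exact: measurableX.
rewrite /lebesgue_rV_cons /pushforward -comp_preimage.
rewrite (_ : _ \o _ = id); last exact/funext/rV_consK.
by rewrite preimage_id product_measure1E// lte_mul_pinfty// ge0_fin_numE.
Qed.

HB.instance Definition _ := Measure_isSigmaFinite.Build _ _ _
  lebesgue_rV_cons cons_sigma_finite.

End lebesgue_rV_cons.

(* Lebesgue measure on R^d as the d-fold product of the one on R;
   lebesgue_rV_box below determines it. *)
Fixpoint lebesgue_rV (R : realType) (d : nat) :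
    {sigma_finite_measure set 'rV[R]_d -> \bar R} :=
  match d return {sigma_finite_measure set 'rV[R]_d -> \bar R} with
  | 0%N => dirac (0 : 'rV[R]_0)
  | d'.+1 => lebesgue_rV_cons (lebesgue_rV R d')
  end.

Lemma measurable_rV_box (R : realType) (d : nat)
    (A : 'I_d -> set (measurableTypeR R)) :
  (forall i, measurable (A i)) ->
  measurable [set x : 'rV[R]_d | forall i, A i (x ord0 i)].
Proof.
move=> mA.
rewrite (_ : mkset _ = \big[setI/setT]_(i < d) (rV_coord i @^-1` A i)).
  apply: bigsetI_measurable => i _; rewrite -[X in measurable X]setTI.
  exact: measurable_rV_coord.
rewrite -bigcap_seq; apply/seteqP; split => x /= h i.
  by move=> _; exact: h.
by apply: h => /=; rewrite mem_index_enum.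
Qed.

Lemma lebesgue_rV_box (R : realType) (d : nat)
    (A : 'I_d -> set (measurableTypeR R)) :
  (forall i, measurable (A i)) ->
  lebesgue_rV R d [set x | forall i, A i (x ord0 i)] =
  (\prod_(i < d) lebesgue_measure (A i))%E.
Proof.
elim: d A => [|d IHd] A mA.
  by rewrite big_ord0 /= diracE mem_set// => -[].
rewrite big_ord_recl /= /lebesgue_rV_cons /pushforward.
rewrite (_ : _ @^-1` _ =
  A ord0 `*` [set x : 'rV[R]_d | forall i, A (lift ord0 i) (x ord0 i)]).
  have mB : measurable
      [set x : 'rV[R]_d | forall i, A (lift ord0 i) (x ord0 i)].
    exact: (@measurable_rV_box R d (fun i => A (lift ord0 i)) (fun i => mA _)).
  rewrite product_measure1E//.
  by congr (_ * _)%E; exact: (IHd (fun i => A (lift ord0 i)) (fun i => mA _)).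
apply/seteqP; split => -[x y] /=.
- move=> h; split => [|i]; first by have := h ord0; rewrite rV_cons0.
  by have := h (lift ord0 i); rewrite rV_consS.
- move=> [hx hy] i; have [->|] := eqVneq i ord0; first by rewrite rV_cons0.
  by rewrite eq_sym => /unlift_some[j -> _]; rewrite rV_consS; exact: hy.
Qed.

Section geometry.
Context (R : realType) (d : nat).
Implicit Types (Om K F : set 'rV[R]_d) (T : set (set 'rV[R]_d)).

Definition enorm (x : 'rV[R]_d) : R := Num.sqrt (\sum_i x ord0 i ^+ 2).

Definition diameter Om : R :=
  sup [set enorm (xy.1 - xy.2) | xy in Om `*` Om].

Definition affinely_independent (V : 'I_d.+1 -> 'rV[R]_d) : Prop :=
  row_free (\matrix_(i < d) (V (lift ord0 i) - V ord0)).

Definition hull (V : 'I_d.+1 -> 'rV[R]_d) (I : {set 'I_d.+1}) : set 'rV[R]_d :=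
  [set x | exists w : 'I_d.+1 -> R,
    [/\ forall i, 0 <= w i, \sum_(i in I) w i = 1
      & x = \sum_(i in I) w i *: V i]].

Definition is_simplex K : Prop :=
  exists2 V, affinely_independent V & K = hull V [set: 'I_d.+1].

(* Vertices, edges and, for d = 3, two-dimensional faces. *)
Definition is_face F K : Prop :=
  exists V (I : {set 'I_d.+1}),
    [/\ affinely_independent V, K = hull V [set: 'I_d.+1],
        (0 < #|I| <= d)%N & F = hull V I].

Definition conforming_mesh Om T : Prop :=
  [/\ finite_set T, forall K, T K -> is_simplex K,
      closure Om = \bigcup_(K in T) K
    & forall K K', T K -> T K' -> K <> K' ->
        K `&` K' = set0 \/ (is_face (K `&` K') K /\ is_face (K `&` K') K')].

(* Near each boundary point, after an orthogonal change of coordinates Q, the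
   domain lies below the graph of a Lipschitz function of the coordinates other
   than the k-th one. *)
Definition lipschitz_boundary Om : Prop :=
  forall x, (closure Om `\` interior Om) x ->
  exists (Q : 'M[R]_d) (k : 'I_d) (g : 'rV[R]_d.-1 -> R),
    [/\ Q *m Q^T = 1%:M, lipschitz g
      & \forall y \near x, Om y <-> (y *m Q) ord0 k < g (col' k (y *m Q))].

Definition polytopal_domain Om : Prop :=
  [/\ [/\ Om !=set0, open Om, bounded_set Om & connected Om],
      exists T, [/\ finite_set T, forall K, T K -> is_simplex K
                  & closure Om = \bigcup_(K in T) K]
    & lipschitz_boundary Om].

End geometry.

(* Elements of L^2 are represented by functions on R^d of which only the values
   on the domain, up to null sets, matter. *)
Section function_spaces.
Context (R : realType) (d : nat) (Om : set 'rV[R]_d).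
Let mu := lebesgue_rV R d.
Implicit Types (f g u phi : 'rV[R]_d -> R) (v w G : 'rV[R]_d -> 'rV[R]_d).

Definition L2 f : Prop :=
  measurable_fun Om f /\ mu.-integrable Om (fun x => (f x ^+ 2)%:E).

Definition L2v v : Prop := forall i, L2 (fun x => v x ord0 i).

Definition ip f g : R := \int[mu]_(x in Om) (f x * g x).

Definition ipv v w : R :=
  \int[mu]_(x in Om) (\sum_i v x ord0 i * w x ord0 i).

Definition L2norm f : R := Num.sqrt (ip f f).

Definition L2normv v : R := Num.sqrt (ipv v v).

Definition pderiv (i : 'I_d) phi : 'rV[R]_d -> R :=
  fun x => 'D_(delta_mx ord0 i) phi x.

Definition grad phi : 'rV[R]_d -> 'rV[R]_d := fun x => \row_i pderiv i phi x.

Fixpoint Ck (k : nat) phi : Prop :=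
  match k with
  | 0%N => continuous phi
  | k'.+1 => continuous phi /\
      forall i : 'I_d, (forall x, derivable phi x (delta_mx ord0 i)) /\
        Ck k' (pderiv i phi)
  end.

Definition test_function phi : Prop :=
  (forall k, Ck k phi) /\
  exists K, [/\ compact K, K `<=` Om & forall x, ~ K x -> phi x = 0].

(* v is in H(div, Om) and its weak divergence is g. As g is determined up to a
   null set only, elements of H(div, Om) are handled together with a
   representative of their divergence; likewise for gradients below. *)
Definition Hdiv v g : Prop :=
  [/\ L2v v, L2 g
    & forall phi, test_function phi -> ipv v (grad phi) = - ip g phi].

(* u is in H^1(Om) and its weak gradient is G. *)
Definition H1 u G : Prop :=
  [/\ L2 u, L2v G
    & forall phi, test_function phi -> forall i,
        ip u (pderiv i phi) = - ip (fun x => G x ord0 i) phi].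

Definition H1norm u G : R := Num.sqrt (L2norm u ^+ 2 + L2normv G ^+ 2).

(* u is in H^1_0(Om), the closure of the test functions in H^1(Om), and its weak
   gradient is G. *)
Definition H10 u G : Prop :=
  H1 u G /\ forall e, 0 < e ->
    exists2 phi, test_function phi & H1norm (u \- phi) (G \- grad phi) < e.

(* The polynomial functions of total degree at most m. *)
Definition polynomial_le (m : nat) (P : 'rV[R]_d -> R) : Prop :=
  exists c : {ffun 'I_d -> 'I_m.+1} -> R, forall x,
    P x = \sum_(e : {ffun 'I_d -> 'I_m.+1} | (\sum_i e i <= m)%N)
            c e * \prod_i x ord0 i ^+ e i.

Variable T : set (set 'rV[R]_d).

Definition Pk (m : nat) f : Prop :=
  L2 f /\ forall K, T K -> exists2 P, polynomial_le m P &
    {ae mu, forall x, Om x -> K x -> f x = P x}.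

Definition RTN (p : nat) v : Prop :=
  L2v v /\ forall K, T K ->
    exists (a : 'I_d -> 'rV[R]_d -> R) (b : 'rV[R]_d -> R),
      [/\ forall i, polynomial_le p (a i), polynomial_le p b
        & {ae mu, forall x, Om x -> K x ->
             v x = (\row_i a i x) + b x *: x}].

Definition is_L2proj (p : nat) g f : Prop :=
  Pk p f /\ forall z, Pk p z -> ip (g \- f) z = 0.

Definition L2proj (p : nat) g : 'rV[R]_d -> R := get (is_L2proj p g).

End function_spaces.

(* m is the minimum of F over A; by convention, the minimum over the empty set
   is +oo. *)
Definition is_min (V : Type) (R : realType) (A : set V) (F : V -> R)
    (m : \bar R) : Prop :=
  m = ereal_inf [set (F v)%:E | v in A] /\
  (A !=set0 -> exists2 v, A v & (F v)%:E = m).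

(* Main.v *)
(* Let [e], [x] be the errors of the flux and of its divergence, [g] the gradient
   error and, for an admissible [v], [r = sig - v] and [y] the projection error.
   Subtracting the two second equations, tested with [v - sigLS = e - r], whose
   divergence is [x - y], gives [h^2 (x, x - y) + (e + g, e - r) = 0].  With the
   squares of [x - y], [2e - r + g] and [r - g] nonnegative, this yields
   [h^2 |x|^2 <= h^2 |y|^2 + |g|^2 + |r|^2].
   The minimum is attained because Raviart-Thomas fields are determined, up to null
   sets, by finitely many coefficients: a maximal orthogonal family of
   divergence-free discrete fields provides the orthogonal projection of
   [sig - v0] for any admissible [v0]. *)
Require Import Defs.
From mathcomp Require Import all_boot all_order all_algebra.
From mathcomp Require Import all_classical all_reals all_analysis.
From mathcomp Require Import measurable_realfun ring lra.

Import Order.TTheory GRing.Theory Num.Theory.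
Import numFieldNormedType.Exports.

Local Open Scope classical_set_scope.
Local Open Scope ring_scope.

Set Implicit Arguments.
Unset Strict Implicit.

(** * Orthogonal projection in a degenerate inner product space *)

Definition is_subspace {R : realFieldType} {V : lmodType R} (W : V -> Prop) : Prop :=
  W 0 /\ forall (a : R) x y, W x -> W y -> W (a *: x + y).

(** The laws are asked on [L] only, since [ip] and [ipv] are additive only where the integrals
    converge. Definiteness is left out: functions that vanish almost everywhere are not identified
    with 0. *)
Definition semi_inner {R : realFieldType} {V : lmodType R} (L : V -> Prop)
    (B : V -> V -> R) : Prop :=
  [/\ forall x y, L x -> L y -> B x y = B y x,
      forall a x y z, L x -> L y -> L z -> B (a *: x + y) z = a * B x z + B y z
    & forall x, L x -> 0 <= B x x].

Section semi_inner_theory.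
Context (R : realFieldType) (V : lmodType R).
Implicit Types (W L : V -> Prop) (B : V -> V -> R) (x y z s w : V).

Lemma subspaceD W x y : is_subspace W -> W x -> W y -> W (x + y).
Proof. by move=> [_ h] Wx Wy; rewrite -[x]scale1r; exact: h. Qed.

Lemma subspaceZ W a x : is_subspace W -> W x -> W (a *: x).
Proof. by move=> [W0 h] Wx; rewrite -[_ *: _]addr0; exact: h. Qed.

Lemma subspaceB W x y : is_subspace W -> W x -> W y -> W (x - y).
Proof. by move=> [_ h] Wx Wy; rewrite addrC -scaleN1r; exact: h. Qed.

Lemma subspace_sum W n (a : nat -> R) (x : nat -> V) : is_subspace W ->
  (forall i, (i < n)%N -> W (x i)) -> W (\sum_(i < n) a i *: x i).
Proof.
move=> sW; elim: n => [_|n IHn Wx]; first by rewrite big_ord0; case: sW.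
rewrite big_ord_recr/=; apply: subspaceD => //.
- by apply: IHn => i /ltnW; exact: Wx.
- by apply: subspaceZ => //; exact: Wx.
Qed.

Context {L : V -> Prop} {B : V -> V -> R}.
Context (sL : is_subspace L) (hB : semi_inner L B).

Lemma semi_innerC x y : L x -> L y -> B x y = B y x.
Proof. by case: hB => h _ _; exact: h. Qed.

Lemma semi_inner_ge0 x : L x -> 0 <= B x x.
Proof. by case: hB => _ _; exact. Qed.

Lemma semi_inner0l z : L z -> B 0 z = 0.
Proof.
case: hB => _ h _ Lz; have L0 := sL.1.
by have := h 1 0 0 z L0 L0 Lz; rewrite scaler0 addr0 mul1r; lra.
Qed.

Lemma semi_innerZl a x z : L x -> L z -> B (a *: x) z = a * B x z.
Proof.
case: hB => _ h _ Lx Lz; rewrite -[a *: x]addr0 h ?semi_inner0l ?addr0//.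
exact: sL.1.
Qed.

Lemma semi_innerDl x y z : L x -> L y -> L z -> B (x + y) z = B x z + B y z.
Proof.
by case: hB => _ h _ Lx Ly Lz; rewrite -[x]scale1r h// scale1r mul1r.
Qed.

Lemma semi_innerBl x y z : L x -> L y -> L z -> B (x - y) z = B x z - B y z.
Proof.
case: hB => _ h _ Lx Ly Lz; rewrite addrC -scaleN1r h// mulN1r.
by rewrite addrC.
Qed.

Lemma semi_innerZr a x z : L x -> L z -> B z (a *: x) = a * B z x.
Proof.
move=> Lx Lz; have La : L (a *: x) by exact: subspaceZ.
by rewrite (semi_innerC Lz La) semi_innerZl// (semi_innerC Lx).
Qed.

Lemma semi_innerDr x y z : L x -> L y -> L z -> B z (x + y) = B z x + B z y.
Proof.
move=> Lx Ly Lz; have Lxy : L (x + y) by exact: subspaceD.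
by rewrite (semi_innerC Lz Lxy) semi_innerDl// !(semi_innerC _ Lz).
Qed.

Lemma semi_innerBr x y z : L x -> L y -> L z -> B z (x - y) = B z x - B z y.
Proof.
move=> Lx Ly Lz; have Lxy : L (x - y) by exact: subspaceB.
by rewrite (semi_innerC Lz Lxy) semi_innerBl// !(semi_innerC _ Lz).
Qed.

Lemma semi_inner_suml n (a : nat -> R) (x : nat -> V) z :
  (forall i, (i < n)%N -> L (x i)) -> L z ->
  B (\sum_(i < n) a i *: x i) z = \sum_(i < n) a i * B (x i) z.
Proof.
move=> + Lz; elim: n => [_|n IHn Lx]; first by rewrite !big_ord0 semi_inner0l.
have Lx' i : (i < n)%N -> L (x i) by move/ltnW; exact: Lx.
rewrite !big_ord_recr/= semi_innerDl ?semi_innerZl ?IHn//.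
- exact: Lx.
- exact: subspace_sum sL Lx'.
- by apply: subspaceZ => //; exact: Lx.
Qed.

(** The degenerate case of Cauchy-Schwarz: for null [x], the square of [t *: x + y] is affine in [t]
    with slope [2 * B x y], and an affine function bounded below is constant. *)
Lemma semi_inner_null x y : L x -> L y -> B x x = 0 -> B x y = 0.
Proof.
move=> Lx Ly Bxx; apply: contrapT => /eqP Bxy.
(* This value of [t] would make the square of [t *: x + y] equal to -1. *)
have Lt : L ((- (B y y + 1) / (2 * B x y)) *: x + y) by apply: sL.2.
have := semi_inner_ge0 Lt.
have Ltx : L ((- (B y y + 1) / (2 * B x y)) *: x) by exact: subspaceZ.
rewrite semi_innerDl// !semi_innerDr// !semi_innerZl// !semi_innerZr// Bxx.
rewrite (semi_innerC Ly Lx) !mulr0 add0r.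
have -> : - (B y y + 1) / (2 * B x y) * B x y = - (B y y + 1) / 2 by field.
lra.
Qed.

(** Members must be non-null, which is stronger than nonzero here. Indexing by [nat], with only the
    first [n] terms relevant, makes it easy to append a vector. *)
Definition orthogonal_family W n (e : nat -> V) : Prop :=
  [/\ forall i, (i < n)%N -> W (e i),
      forall i, (i < n)%N -> B (e i) (e i) != 0
    & forall i j, (i < n)%N -> (j < n)%N -> i != j -> B (e i) (e j) = 0].

Lemma semi_inner_orthogonal_family W n e (a : nat -> R) j :
  (forall x, W x -> L x) -> orthogonal_family W n e -> (j < n)%N ->
  B (\sum_(i < n) a i *: e i) (e j) = a j * B (e j) (e j).
Proof.
move=> WL [We _ oe] jn; rewrite semi_inner_suml//; first last.
- exact/WL/We.
- by move=> i ?; exact/WL/We.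
rewrite (bigD1 (Ordinal jn))//= big1 ?addr0// => i ij.
by rewrite oe ?mulr0// -[j]/(val (Ordinal jn)).
Qed.

(* More than [N] coordinate vectors in dimension [N] are dependent, so some
   nontrivial combination of the family has zero coordinates, hence is null. *)
Lemma orthogonal_family_bound W N (coef : V -> 'rV[R]_N -> Prop) n e :
  (forall x, W x -> L x) ->
  (forall x, W x -> exists c, coef x c) ->
  (forall x, L x -> coef x 0 -> B x x = 0) ->
  (coef 0 0) ->
  (forall a x y c c', coef x c -> coef y c' -> coef (a *: x + y) (a *: c + c')) ->
  orthogonal_family W n e -> (n <= N)%N.
Proof.
move=> WL Wc c0 coef0 coefD oe; rewrite leqNgt; apply/negP => Nn.
have [We Be _] := oe.
have /choice[c hc] : forall i, exists c : 'rV[R]_N, (i < n)%N -> coef (e i) c.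
  move=> i; case: (ltnP i n) => [/We/Wc[c ?]|_]; first by exists c.
  by exists 0.
pose M := \matrix_(i < n) c i.
have : kermx M != 0.
  rewrite -mxrank_eq0 mxrank_ker -lt0n subn_gt0.
  exact: leq_ltn_trans (rank_leq_col _) _.
move=> /rowV0Pn[l lM l0].
(* The kernel vector [l] as a sequence, zero from [n] on. *)
pose a i := if insub i is Some k then l ord0 (k : 'I_n) else 0.
have aE (i : 'I_n) : a i = l ord0 i by rewrite /a valK.
have coef_sum m : (m <= n)%N ->
    coef (\sum_(i < m) a i *: e i) (\sum_(i < m) a i *: c i).
  elim: m => [_|m IHm mn]; first by rewrite !big_ord0.
  rewrite !big_ord_recr/= addrC [X in coef _ X]addrC.
  by apply: coefD; [exact: hc|exact/IHm/ltnW].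
have := coef_sum n (leqnn _).
have -> : \sum_(i < n) a i *: c i = 0.
  transitivity (l *m M); last exact/sub_kermxP.
  by rewrite mulmx_sum_row; apply: eq_bigr => i _; rewrite aE rowK.
have Lx : L (\sum_(i < n) a i *: e i).
  by apply: (@subspace_sum _ n a e sL) => i /We/WL.
move=> /(c0 _ Lx) /semi_inner_null null.
(* Pairing the null combination with [e j] leaves the product of [l ord0 j] and [B (e j) (e j)],
   both nonzero. *)
move/rV0Pn : l0 => [j lj].
have := null _ Lx (WL _ (We _ (ltn_ord j))).
rewrite (semi_inner_orthogonal_family _ WL oe)// aE => /eqP.
by rewrite mulf_eq0 (negbTE lj) (negbTE (Be _ _)).
Qed.

(** The relation [coef] only serves to bound the dimension of [W] modulo null vectors; it is a
    relation because a vector may have several coordinate rows. An orthogonal family of maximal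
    length then exists, and projecting onto its span is projecting onto [W]. *)
Lemma orthogonal_projection W N (coef : V -> 'rV[R]_N -> Prop) s :
  is_subspace W ->
  (forall x, W x -> L x) ->
  (forall x, W x -> exists c, coef x c) ->
  (forall x, L x -> coef x 0 -> B x x = 0) ->
  (coef 0 0) ->
  (forall a x y c c', coef x c -> coef y c' -> coef (a *: x + y) (a *: c + c')) ->
  L s -> exists2 w, W w & forall z, W z -> B (s - w) z = 0.
Proof.
move=> sW WL Wc c0 coef0 coefD Ls.
have exP : exists n, `[< exists e, orthogonal_family W n e >].
  by exists 0%N; apply/asboolP; exists (fun=> 0); split.
have ubP n : `[< exists e, orthogonal_family W n e >] -> (n <= N)%N.
  by move=> /asboolP[e]; exact: (orthogonal_family_bound WL Wc c0 coef0 coefD).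
case: (ex_maxnP exP ubP) => n /asboolP[e oe] nmax.
have [We Be eo] := oe.
pose P x := \sum_(i < n) (B x (e i) / B (e i) (e i)) *: e i.
have WP x : W (P x).
  exact: (@subspace_sum W n (fun i => B x (e i) / B (e i) (e i)) e sW We).
have PE x j : L x -> (j < n)%N -> B (x - P x) (e j) = 0.
  move=> Lx jn; rewrite semi_innerBl//; first last.
  - exact/WL/We.
  - exact/WL/WP.
  have /= -> := semi_inner_orthogonal_family
    (fun i => B x (e i) / B (e i) (e i)) WL oe jn.
  by rewrite divfK ?subrr// Be.
exists (P s) => // z Wz.
have LsP : L (s - P s) by apply: subspaceB => //; exact/WL.
have WzP : W (z - P z) by exact: subspaceB.
(* By maximality: a non-null residual [z - P z] could be appended to the family. *)
have zP0 : B (z - P z) (z - P z) = 0.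
  apply: contrapT => /eqP nz.
  suff /nmax : `[< exists e, orthogonal_family W n.+1 e >] by rewrite ltnn.
  apply/asboolP; exists (fun i => if i == n then z - P z else e i).
  have lt i : (i < n.+1)%N -> i != n -> (i < n)%N.
    by rewrite ltnS leq_eqVlt => /orP[->|].
  split => [i iN|i iN|i j iN jN].
  - by case: eqVneq => // iNn; exact/We/lt.
  - case: (eqVneq i n) => [_|iNn] //.
    exact: Be _ (lt _ iN iNn).
  - case: (eqVneq i n) => [->|iNn].
      rewrite eq_sym; case: eqVneq => // jNn _.
      by apply: PE; [exact: WL Wz|exact: lt jN jNn].
    case: (eqVneq j n) => [_ _|jNn ij]; last by apply: eo => //; exact: lt.
    rewrite semi_innerC; [|exact/WL/We/(lt _ iN)|exact: WL WzP].
    by apply: PE; [exact: WL Wz|exact: lt iN iNn].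
(* The null part is orthogonal to all of [L], and [P z] is a combination of the [e i], each
   orthogonal to [s - P s]. *)
have -> : z = (z - P z) + P z by rewrite subrK.
rewrite semi_innerDr//; [|exact: WL|exact/WL/WP].
rewrite semi_innerC//; last exact: WL.
rewrite (semi_inner_null (WL _ WzP) LsP zP0) add0r.
rewrite (semi_innerC LsP (WL _ (WP z))).
have /= -> := semi_inner_suml (fun i => B z (e i) / B (e i) (e i))
  (fun i (iN : (i < n)%N) => WL _ (We i iN)) LsP.
rewrite big1// => i _; rewrite [X in _ * X](semi_innerC _ LsP); last exact/WL/We.
by rewrite PE ?mulr0.
Qed.

(** Pythagoras: in [s - z = (s - w) + (w - z)] the second term lies in [W], so the cross terms
    vanish. *)
Lemma orthogonal_projection_min W s w : is_subspace W ->
  (forall x, W x -> L x) -> L s -> W w ->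
  (forall z, W z -> B (s - w) z = 0) ->
  forall z, W z -> B (s - w) (s - w) <= B (s - z) (s - z).
Proof.
move=> sW WL Ls Ww ortho z Wz.
have Wwz : W (w - z) by exact: subspaceB.
have Lwz := WL _ Wwz.
have Lsw : L (s - w) by apply: subspaceB => //; exact: WL.
have Lsz : L (s - w + (w - z)) by exact: subspaceD.
have -> : s - z = (s - w) + (w - z) by rewrite addrA subrK.
rewrite (semi_innerDl Lsw Lwz Lsz) !(semi_innerDr Lsw Lwz)//.
rewrite (semi_innerC Lwz Lsw) (ortho _ Wwz) addr0 add0r.
by rewrite lerDl semi_inner_ge0.
Qed.

End semi_inner_theory.

(** * Borel sets and bounded sets in the space of row vectors *)

Section borel_rV.
Context (R : realType) (d : nat).
Implicit Types (Om : set 'rV[R]_d).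

(** Balls are those of the sup norm, so every point of [Om] lies in a box with rational corners
    inside [Om], and such boxes are countably many. *)
Lemma open_measurable_rV Om : open Om -> measurable Om.
Proof.
move=> oOm.
pose box (b : {ffun 'I_d -> rat} * {ffun 'I_d -> rat}) : set 'rV[R]_d :=
  [set x | forall i, `]ratr (b.1 i), ratr (b.2 i)[%classic (x ord0 i)].
(* Boxes not inside [Om] become empty, so that the union runs over a whole countable type. *)
pose F b := if `[< box b `<=` Om >] then box b else set0.
have -> : Om = \bigcup_b F b.
  apply/seteqP; split => [x Omx|x [b _]]; last first.
    by rewrite /F; case: asboolP => // bOm /bOm.
  have := oOm x Omx; rewrite -nbhs_ballE => -[e /= e0 xeOm].
  have /choice[l hl] : forall i, exists l : rat, ratr l \in `]x ord0 i - e, x ord0 i[.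
    by move=> i; apply: rat_in_itvoo; lra.
  have /choice[r hr] : forall i, exists r : rat, ratr r \in `]x ord0 i, x ord0 i + e[.
    by move=> i; apply: rat_in_itvoo; lra.
  exists (finfun l, finfun r) => //; rewrite /F asboolT.
    move=> i /=; rewrite !ffunE in_itv/=.
    by have := hl i; have := hr i; rewrite !in_itv/=; lra.
  move=> y /= hy; apply: xeOm;
  split => // i j; rewrite ord1 /ball/= ltr_distlC.
  have := hy j; have := hl j; have := hr j; rewrite /= !ffunE !in_itv/=; lra.
apply: countable_bigcupT_measurable => // b; rewrite /F; case: asboolP => // _.
apply: (@measurable_rV_box R d
  (fun i => `]ratr (b.1 i), ratr (b.2 i)[%classic)) => i.
exact: measurable_itv.
Qed.

Lemma continuous_measurable_rV (phi : 'rV[R]_d -> R) :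
  continuous phi -> measurable_fun setT phi.
Proof.
move=> cphi; apply: (measurability _ (RGenOpens.measurableE R)).
move=> _ [_ [x [y ->] <-]]; rewrite setTI; apply: open_measurable_rV.
move/continuousP : cphi; apply; exact: interval_open.
Qed.

Lemma bounded_subset_box Om : bounded_set Om -> exists2 M : R, 0 <= M &
  Om `<=` [set x | forall i, `[- M, M]%classic (x ord0 i)].
Proof.
(* [bounded_set] provides bounds strictly above [M] only, and [M] may be negative. *)
move=> [M [_ hM]]; exists (`|M| + 1); first by rewrite addr_ge0.
move=> x Omx i /=; rewrite in_itv/= -ler_norml.
apply: le_trans (hM (`|M| + 1) _ _ Omx); last first.
  by rewrite (le_lt_trans (ler_norm _))// ltrDl.
by rewrite [leRHS]/Num.norm /= mx_normrE; apply: (le_bigmax _ _ (ord0, i)).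
Qed.

Lemma bounded_lebesgue_rV Om : measurable Om -> bounded_set Om ->
  (lebesgue_rV R d Om < +oo)%E.
Proof.
move=> mOm /bounded_subset_box[M M0 OmM].
apply: (@le_lt_trans _ _ (lebesgue_rV R d
  [set x | forall i, `[- M, M]%classic (x ord0 i)])).
  apply: le_measure => //; rewrite inE//.
  apply: (@measurable_rV_box R d (fun=> `[- M, M]%classic)) => i.
  exact: measurable_itv.
rewrite (@lebesgue_rV_box R d (fun=> `[- M, M]%classic)); last first.
  by move=> i; exact: measurable_itv.
set p := (\prod_(i < d) _)%E; suff : (p \is a fin_num)%E.
  by rewrite ltey_eq => ->.
rewrite /p; elim/big_ind : _ => // [x y|i _]; first exact: fin_numM.
by rewrite lebesgue_measure_itv/=; case: ifP.
Qed.

(** Since [phi] is continuous on the whole space, it is bounded on a compact box around [Om]. *)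
Lemma continuous_bounded_rV Om (phi : 'rV[R]_d -> R) :
  bounded_set Om -> continuous phi -> [bounded phi x : R^o | x in Om].
Proof.
move=> /bounded_subset_box[M M0 OmM] cphi.
pose box := [set x : 'rV[R]_d | forall i, `[- M, M]%classic (x ord0 i)].
have cbox : compact box.
  by apply: (@rV_compact R d (fun=> `[- M, M]%classic)) => i; exact: segment_compact.
have /compact_bounded[N [Nr hN]] : compact ((phi : _ -> R^o) @` box).
  by apply: continuous_compact => //; exact: continuous_subspaceT.
exists N; split => // t Nt x Omx; apply: (hN t Nt); exists x => //.
exact: OmM.
Qed.

End borel_rV.

(** * Square-integrable functions and fields, and linearity of the weak divergence *)

Section L2_theory.
Context (R : realType) (d : nat) (Om : set 'rV[R]_d).
Context (mOm : measurable Om).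
Let mu := lebesgue_rV R d.
Implicit Types (f g h : 'rV[R]_d -> R^o) (v w z : 'rV[R]_d -> 'rV[R]_d).

(** The product is dominated by the sum of the squares, by expanding the squares of [f + g] and
    [f - g]. *)
Lemma L2_integrableM f g : L2 Om f -> L2 Om g ->
  mu.-integrable Om (EFin \o (fun x => f x * g x)).
Proof.
move=> [mf f2] [mg g2].
apply: (@le_integrable _ _ _ mu Om mOm _
  ((fun x => (f x ^+ 2)%:E) \+ (fun x => (g x ^+ 2)%:E))%E).
- by apply/measurable_EFinP; exact: measurable_funM.
- move=> x _ /=; rewrite lee_fin (ger0_norm (addr_ge0 _ _)) ?sqr_ge0//.
  rewrite ler_norml; apply/andP; split.
    have := sqr_ge0 (f x + g x); nra.
  have := sqr_ge0 (f x - g x); nra.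
- exact: integrableD.
Qed.

Lemma L2_subspace : is_subspace (@L2 R d Om : ('rV[R]_d -> R^o) -> Prop).
Proof.
split => [|a f g [mf f2] [mg g2]].
  split; first exact: measurable_cst.
  rewrite (_ : (fun _ => _) = cst 0%E); first exact: integrable0.
  by apply/funext => x; rewrite expr0n.
split; first by apply: measurable_funD => //; exact: measurable_funM.
(* The dominating function comes from $(af+g)^2 \le 2a^2f^2 + 2g^2$. *)
apply: (@le_integrable _ _ _ mu Om mOm _
  ((fun x => (2 * a ^+ 2)%:E * (f x ^+ 2)%:E) \+ 
   (fun x => 2%:E * (g x ^+ 2)%:E))%E).
- apply/measurable_EFinP/measurable_funX.
  by apply: measurable_funD => //; exact: measurable_funM.
- move=> x _; have -> : (a *: f + g) x = a * f x + g x by [].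
  rewrite /= lee_fin !ger0_norm ?sqr_ge0//.
    have := sqr_ge0 (a * f x - g x); nra.
  by rewrite addr_ge0// mulr_ge0 ?sqr_ge0// mulr_ge0 ?sqr_ge0.
- by apply: integrableD => //; exact: integrableZl.
Qed.

Lemma ip_semi_inner : semi_inner (@L2 R d Om : ('rV[R]_d -> R^o) -> Prop)
  (@ip R d Om).
Proof.
split => [f g _ _|a f g h f2 g2 h2|f _].
- by apply: eq_Rintegral => x _; rewrite mulrC.
- have ifh := L2_integrableM f2 h2; have igh := L2_integrableM g2 h2.
  rewrite /ip -RintegralZl// -RintegralD//.
    by apply: eq_Rintegral => x _; rewrite mulrDl mulrA.
  exact: (integrableZl mOm a ifh).
- by apply: Rintegral_ge0 => x _; exact: sqr_ge0.
Qed.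

Lemma ipvE v w : L2v Om v -> L2v Om w ->
  ipv Om v w = \sum_i ip Om (fun x => v x ord0 i) (fun x => w x ord0 i).
Proof.
move=> v2 w2; rewrite /ipv /ip /Rintegral.
have ivw i := L2_integrableM (v2 i) (w2 i).
rewrite sum_fine => [|i _]; last exact: integrable_fin_num (ivw i).
rewrite -(integral_sum mOm ivw); congr fine.
by apply: eq_integral => x _; rewrite sumEFin.
Qed.

Lemma L2v_subspace : is_subspace (@L2v R d Om).
Proof.
split => [|a v w v2 w2] i.
  rewrite (_ : (fun _ => _) = 0); first by case: L2_subspace.
  by apply/funext => x; rewrite mxE.
rewrite (_ : (fun _ => _) =
    a *: (fun x => v x ord0 i : R^o) + (fun x => w x ord0 i : R^o)).
  by apply: L2_subspace.2.
by apply/funext => x; rewrite !mxE.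
Qed.

Lemma ipv_semi_inner : semi_inner (@L2v R d Om) (@ipv R d Om).
Proof.
have [ipC ipD ip_ge0] := ip_semi_inner.
split => [v w v2 w2|a v w z v2 w2 z2|v v2].
- by rewrite !ipvE//; apply: eq_bigr => i _; exact: ipC.
- rewrite !ipvE//; last exact: L2v_subspace.2.
  rewrite mulr_sumr -big_split/=; apply: eq_bigr => i _.
  rewrite -ipD//; congr ip; apply/funext => x.
  by rewrite !mxE.
- by rewrite ipvE//; apply: sumr_ge0 => i _; exact: ip_ge0.
Qed.

Lemma ipv_null v : {ae mu, forall x, Om x -> v x = 0} -> L2v Om v ->
  ipv Om v v = 0.
Proof.
move=> v0 v2; rewrite ipvE// big1// => i _; rewrite /ip /Rintegral.
rewrite (_ : integral _ _ _ = 0%E)//.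
have := L2_integrableM (v2 i) (v2 i) => /integrableP[mvv _].
rewrite (@ae_eq_integral _ _ _ mu Om (cst 0%E))//.
  exact: integral0.
by apply: filterS v0 => x v0 /v0 /= ->; rewrite mxE mulr0.
Qed.

Context (bOm : bounded_set Om).

Lemma continuous_L2 f : continuous f -> L2 Om f.
Proof.
move=> cf; split; first exact: measurable_funTS (continuous_measurable_rV cf).
have cff : continuous (fun x => f x ^+ 2 : R^o).
  by move=> x; exact: (continuousM (cf x) (cf x)).
apply: (@measurable_bounded_integrable _ _ _ mu (fun x => f x ^+ 2)) => //.
- exact: bounded_lebesgue_rV.
- exact: measurable_funTS (continuous_measurable_rV cff).
- exact: continuous_bounded_rV cff.
Qed.

(** Test functions and their gradients are continuous, hence square integrable on the bounded [Om];
    this makes both sides of the weak divergence identity linear. *)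
Lemma Hdiv_comb a v w g h : Hdiv Om v g -> Hdiv Om w h ->
  Hdiv Om (a *: v + w) (a *: (g : _ -> R^o) + (h : _ -> R^o)).
Proof.
move=> [v2 g2 vg] [w2 h2 wh].
split; [exact: L2v_subspace.2|exact: L2_subspace.2|move=> phi tphi].
have phi2 : L2 Om phi by apply: continuous_L2; exact: (tphi.1 0%N).
have gphi2 : L2v Om (grad phi).
  move=> i; rewrite (_ : (fun _ => _) = pderiv i phi).
    by apply: continuous_L2; exact: ((tphi.1 1%N).2 i).2.
  by apply/funext => x; rewrite mxE.
have [_ ipD _] := ip_semi_inner; have [_ ipvD _] := ipv_semi_inner.
by rewrite ipD// ipvD// vg// wh//; ring.
Qed.

End L2_theory.

(** * Finite coordinates for Raviart-Thomas fields *)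

Section RTN_theory.
Context (R : realType) (d : nat) (Om : set 'rV[R]_d) (T : set (set 'rV[R]_d)).
Context (mOm : measurable Om).
Let mu := lebesgue_rV R d.
Implicit Types (v w : 'rV[R]_d -> 'rV[R]_d).

Lemma polynomial_le_comb m a (P Q : 'rV[R]_d -> R) :
  polynomial_le m P -> polynomial_le m Q ->
  polynomial_le m (fun x => a * P x + Q x).
Proof.
move=> [c hP] [c' hQ]; exists (fun e => a * c e + c' e) => x.
rewrite hP hQ mulr_sumr -big_split/=; apply: eq_bigr => e _.
by rewrite mulrDl mulrA.
Qed.

Lemma polynomial_le0 m : polynomial_le m (0 : 'rV[R]_d -> R).
Proof. by exists (fun=> 0) => x; rewrite big1// => e _; rewrite mul0r. Qed.

Lemma RTN_subspace p : is_subspace (RTN Om T p).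
Proof.
split => [|a v w [v2 hv] [w2 hw]].
  split; first by case: (L2v_subspace mOm).
  move=> K TK; exists (fun=> fun=> 0), (fun=> 0); split => //.
  - by move=> i; exact: polynomial_le0.
  - exact: polynomial_le0.
  - apply: aeW => x _ _; apply/rowP => i.
    by rewrite !mxE mul0r addr0.
split; first exact: (L2v_subspace mOm).2.
move=> K TK; have [a1 [b1 [ha1 hb1 e1]]] := hv K TK.
have [a2 [b2 [ha2 hb2 e2]]] := hw K TK.
exists (fun i x => a * a1 i x + a2 i x), (fun x => a * b1 x + b2 x); split.
- by move=> i; exact: polynomial_le_comb.
- exact: polynomial_le_comb.
- apply: filterS2 e1 e2 => x e1 e2 Omx Kx.
  have -> : (a *: v + w) x = a *: v x + w x by [].
  by rewrite e1// e2//; apply/rowP => i; rewrite !mxE; ring.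
Qed.

Context (s : seq (set 'rV[R]_d)) (p : nat).

(** A triple of a simplex in the list [s], a polynomial of the local representation and a
    multi-exponent. Exponents of total degree above [p] are indexed too, but [RTN_eval] skips
    them. *)
Definition RTN_index : finType :=
  ('I_(size s) * option 'I_d * {ffun 'I_d -> 'I_p.+1})%type.

Definition RTN_eval (c : 'rV[R]_#|RTN_index|) k o (x : 'rV[R]_d) : R :=
  \sum_(e : {ffun 'I_d -> 'I_p.+1} | (\sum_i e i <= p)%N)
    c ord0 (enum_rank ((k, o, e) : RTN_index)) * \prod_i x ord0 i ^+ e i.

(* [None] indexes the coefficients of the polynomial multiplying [x], [Some i]
   those of the i-th component of the remaining part. *)
Definition RTN_coef v (c : 'rV[R]_#|RTN_index|) : Prop :=
  forall k : 'I_(size s), {ae mu, forall x, Om x -> nth set0 s k x ->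
    v x = (\row_i RTN_eval c k (Some i) x) + RTN_eval c k None x *: x}.

Lemma RTN_eval_comb a c c' k o x : RTN_eval (a *: c + c') k o x =
  a * RTN_eval c k o x + RTN_eval c' k o x.
Proof.
rewrite /RTN_eval mulr_sumr -big_split/=; apply: eq_bigr => e _.
by rewrite !mxE mulrDl mulrA.
Qed.

Lemma RTN_eval0 k o x : RTN_eval 0 k o x = 0.
Proof. by rewrite /RTN_eval big1// => e _; rewrite mxE mul0r. Qed.

Lemma RTN_coef_comb a v w c c' : RTN_coef v c -> RTN_coef w c' ->
  RTN_coef (a *: v + w) (a *: c + c').
Proof.
move=> hv hw k; apply: filterS2 (hv k) (hw k) => x e1 e2 Omx Kx.
have -> : (a *: v + w) x = a *: v x + w x by [].
rewrite e1// e2//; apply/rowP => i; rewrite !mxE !RTN_eval_comb; ring.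
Qed.

Lemma RTN_coef0 : RTN_coef 0 0.
Proof.
move=> k; apply: aeW => x _ _; apply/rowP => i.
by rewrite !mxE !RTN_eval0 mul0r addr0.
Qed.

Lemma RTN_coef_null v : Om `<=` \bigcup_(K in [set` s]) K -> RTN_coef v 0 ->
  {ae mu, forall x, Om x -> v x = 0}.
Proof.
move=> Oms hv.
have : {ae mu, forall x, forall k : 'I_(size s), Om x -> nth set0 s k x ->
    v x = (\row_i RTN_eval 0 k (Some i) x) + RTN_eval 0 k None x *: x}.
  (* There are finitely many simplices, so one null set serves them all. *)
  exact: filter_forall.
apply: filterS => x hx Omx; have [K /= Ks Kx] := Oms x Omx.
have sK : (index K s < size s)%N by rewrite index_mem.
have /= -> := hx (Ordinal sK) Omx; last by rewrite /= nth_index.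
by apply/rowP => i; rewrite !mxE !RTN_eval0 mul0r addr0.
Qed.

Lemma RTN_coefP v : T = [set` s] -> RTN Om T p v -> exists c, RTN_coef v c.
Proof.
move=> Ts [_ hv].
have /choice[c hc] (k : 'I_(size s)) : exists c : option 'I_d ->
    {ffun 'I_d -> 'I_p.+1} -> R,
    let ev o x := \sum_(e : {ffun 'I_d -> 'I_p.+1} | (\sum_i e i <= p)%N)
      c o e * \prod_i x ord0 i ^+ e i in
    {ae mu, forall x, Om x -> nth set0 s k x ->
      v x = (\row_i ev (Some i) x) + ev None x *: x}.
  have [|a [b [/choice[ca ha] [cb hb] e]]] := hv (nth set0 s k).
    by rewrite Ts/= mem_nth.
  exists (fun o => if o is Some i then ca i else cb).
  apply: filterS e => x e Omx Kx; rewrite e//= hb.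
  by congr (_ + _); apply/rowP => i; rewrite !mxE ha.
exists (\row_j let: (k, o, e) := enum_val j in c k o e) => k.
apply: filterS (hc k) => x e Omx Kx; rewrite e//=.
have evE o : RTN_eval (\row_j let: (k, o, e) := enum_val j in c k o e) k o x =
    \sum_(e : {ffun 'I_d -> 'I_p.+1} | (\sum_i e i <= p)%N)
      c k o e * \prod_i x ord0 i ^+ e i.
  by apply: eq_bigr => f _; rewrite mxE enum_rankK.
by rewrite evE; congr (_ + _); apply/rowP => i; rewrite !mxE evE.
Qed.

End RTN_theory.

(** * The error inequality for abstract semi-inner products *)

Lemma galerkin_bound (R : realFieldType) (V1 V2 : lmodType R)
    (L1 : V1 -> Prop) (L2 : V2 -> Prop) (B1 : V1 -> V1 -> R)
    (B2 : V2 -> V2 -> R) (h : R) (x y : V1) (e r g : V2) :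
  is_subspace L1 -> is_subspace L2 -> semi_inner L1 B1 -> semi_inner L2 B2 ->
  L1 x -> L1 y -> L2 e -> L2 r -> L2 g ->
  h ^+ 2 * B1 x (x - y) + B2 (e + g) (e - r) = 0 ->
  h ^+ 2 * B1 x x <= h ^+ 2 * B1 y y + B2 g g + B2 r r.
Proof.
move=> s1 s2 hB1 hB2 Lx Ly Le Lr Lg.
have Lrg : L2 (r - g) by exact: subspaceB.
have Le2 : L2 (2 *: e) by exact: subspaceZ.
have Lxy : L1 (x - y) by exact: subspaceB.
have Ler : L2 (e - r) by exact: subspaceB.
have Lerg : L2 (2 *: e - (r - g)) by exact: subspaceB.
have Leg : L2 (e + g) by exact: subspaceD.
(* Given the orthogonality hypothesis, $h^2|x|^2 + h^2|x-y|^2 + \frac12|2e-r+g|^2 + \frac12|r-g|^2 =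
   h^2|y|^2 + |g|^2 + |r|^2$. The lines below expand the squares so that [lra] can find this
   combination. *)
have := semi_inner_ge0 hB2 Lrg.
have := semi_inner_ge0 hB2 Lerg.
have := mulr_ge0 (sqr_ge0 h) (semi_inner_ge0 hB1 Lxy).
rewrite (semi_innerBl hB1)// !(semi_innerBr s1 hB1)//.
rewrite (semi_innerC hB1 Ly Lx).
rewrite !(semi_innerBl hB2)// !(semi_innerBr s2 hB2)//.
rewrite !(semi_innerZl s2 hB2)// !(semi_innerZr s2 hB2)//.
rewrite !(semi_innerDl hB2)//.
rewrite (semi_innerC hB2 Lr Le) (semi_innerC hB2 Lg Le) (semi_innerC hB2 Lg Lr).
lra.
Qed.

(** * Existence of a best discrete flux with prescribed divergence *)

Section RTN_minimizer.
Context (R : realType) (d : nat) (Om : set 'rV[R]_d) (T : set (set 'rV[R]_d)).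
Context (oOm : open Om) (bOm : bounded_set Om).
Context (fT : finite_set T) (OmT : Om `<=` \bigcup_(K in T) K).

Lemma L2normE (f : 'rV[R]_d -> R) : L2norm Om f ^+ 2 = ip Om f f.
Proof. by rewrite sqr_sqrtr//; apply: Rintegral_ge0 => x _; exact: sqr_ge0. Qed.

Lemma L2normvE (v : 'rV[R]_d -> 'rV[R]_d) : L2normv Om v ^+ 2 = ipv Om v v.
Proof.
rewrite sqr_sqrtr//; apply: Rintegral_ge0 => x _; apply: sumr_ge0 => i _.
exact: sqr_ge0.
Qed.

Lemma RTN_Hdiv_minimizer p (g : 'rV[R]_d -> R) sig v0 : L2v Om sig ->
  RTN Om T p v0 -> Hdiv Om v0 g ->
  exists2 v, RTN Om T p v /\ Hdiv Om v g &
    forall w, RTN Om T p w -> Hdiv Om w g ->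
      L2normv Om (sig \- v) ^+ 2 <= L2normv Om (sig \- w) ^+ 2.
Proof.
move=> sig2 v0R v0g.
have mOm := open_measurable_rV oOm.
have [s Ts] := (finite_seqP T).1 fT.
have Oms : Om `<=` \bigcup_(K in [set` s]) K by rewrite -Ts.
have sL := L2v_subspace mOm; have hB := ipv_semi_inner mOm.
have sR := RTN_subspace T mOm p.
have v02 : L2v Om v0 by case: v0g.
(* The admissible fields form the affine space [v0 + W], so the task is to project [sig - v0] onto
   [W]. *)
pose W w := RTN Om T p w /\ Hdiv Om w (fun=> 0).
have WL w : W w -> L2v Om w by move=> [[]].
have Wdiff w w' : RTN Om T p w -> Hdiv Om w g -> RTN Om T p w' ->
    Hdiv Om w' g -> W (w - w').
  move=> wR wg w'R w'g; split; first exact: subspaceB.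
  rewrite addrC -scaleN1r (_ : (fun=> 0) = (-1) *: (g : _ -> R^o) + g).
    exact: Hdiv_comb.
  by rewrite scaleN1r addNr.
have sW : is_subspace W.
  split; first by rewrite -(subrr v0); exact: Wdiff.
  move=> a x y [xR x0] [yR y0]; split; first exact: sR.2.
  rewrite (_ : (fun=> 0) = a *: ((fun=> 0) : _ -> R^o) + (fun=> 0)).
    exact: Hdiv_comb.
  by apply/funext => z /=; rewrite !fctE/= scaler0 addr0.
have Ls : L2v Om (sig - v0) by exact: (subspaceB sL).
have [w Ww ortho] := @orthogonal_projection _ _ _ _ sL hB W _
  (@RTN_coef R d Om s p) (sig - v0) sW WL
  (fun x Wx => RTN_coefP Ts Wx.1)
  (fun x x2 x0 => ipv_null mOm (RTN_coef_null Oms x0) x2)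
  (@RTN_coef0 _ _ _ _ _) (@RTN_coef_comb _ _ _ _ _) Ls.
have wmin := orthogonal_projection_min sL hB sW WL Ls Ww ortho.
exists (v0 + w).
  have [wR w0] := Ww; split; first exact: subspaceD.
  rewrite addrC -[w]scale1r (_ : g = 1 *: ((fun=> 0) : _ -> R^o) + (g : _ -> R^o)).
    exact: Hdiv_comb.
  by apply/funext => z; rewrite !fctE/= scaler0 add0r.
(* The competitor [v] corresponds to the element [v - v0] of [W]. *)
move=> v vR vg; rewrite !L2normvE.
have := wmin _ (Wdiff _ _ vR vg v0R v0g).
have -> : sig - v0 - w = sig - (v0 + w) by rewrite opprD addrA.
by have -> : sig - v0 - (v - v0) = sig - v by rewrite opprB addrA subrK.
Qed.

End RTN_minimizer.

(** * The a priori estimate for the divergence error *)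

Unset Implicit Arguments.
Set Strict Implicit.

Theorem lemma6p3 (R : realType) (d : nat) (hd : d = 2%N \/ d = 3%N)
  (Om : set 'rV[R]_d) (hOm : polytopal_domain Om)
  (T : set (set 'rV[R]_d)) (hT : conforming_mesh Om T)
  (p q : nat) (hq : (1 <= q)%N)
  (f : 'rV[R]_d -> R) (hf : L2 Om f)
  (sig sigLS : 'rV[R]_d -> 'rV[R]_d) (dsig dsigLS : 'rV[R]_d -> R)
  (u uLS : 'rV[R]_d -> R) (gu guLS : 'rV[R]_d -> 'rV[R]_d)
  (hsig : Hdiv Om sig dsig) (hu : H10 Om u gu)
  (eq1 : forall v gv, H10 Om v gv -> ipv Om (sig \+ gu) gv = 0)
  (eq2 : forall w dw, Hdiv Om w dw ->
     diameter Om ^+ 2 * ip Om dsig dw + ipv Om (sig \+ gu) w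
     = diameter Om ^+ 2 * ip Om f dw)
  (hsigLS : RTN Om T p sigLS /\ Hdiv Om sigLS dsigLS)
  (huLS : Pk Om T q uLS /\ H10 Om uLS guLS)
  (eqLS1 : forall v gv, Pk Om T q v /\ H10 Om v gv ->
     ipv Om (sigLS \+ guLS) gv = 0)
  (eqLS2 : forall w dw, RTN Om T p w /\ Hdiv Om w dw ->
     diameter Om ^+ 2 * ip Om dsigLS dw + ipv Om (sigLS \+ guLS) w
     = diameter Om ^+ 2 * ip Om f dw) :
  exists2 m : \bar R,
    is_min [set v | RTN Om T p v /\ Hdiv Om v (L2proj Om T p dsig)]
      (fun v => L2normv Om (sig \- v) ^+ 2) m &
    ((diameter Om ^+ 2 * L2norm Om (dsig \- dsigLS) ^+ 2)%:E <=
     (diameter Om ^+ 2 * L2norm Om (dsig \- L2proj Om T p dsig) ^+ 2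
      + L2normv Om (gu \- guLS) ^+ 2)%:E + m)%E.
Proof.
have [[_ oOm bOm _] _ _] := hOm; have [fT _ ClOm _] := hT.
have mOm := open_measurable_rV oOm.
have OmT : Om `<=` \bigcup_(K in T) K by rewrite -ClOm; exact: subset_closure.
set A := [set v | _]; set F := fun v => L2normv Om (sig \- v) ^+ 2.
set P := L2proj Om T p dsig.
have bound v : A v -> diameter Om ^+ 2 * L2norm Om (dsig \- dsigLS) ^+ 2 <=
    diameter Om ^+ 2 * L2norm Om (dsig \- P) ^+ 2
    + L2normv Om (gu \- guLS) ^+ 2 + F v.
  move=> [vR vP]; have [sLSR sLSd] := hsigLS.
  have [sig2 dsig2 _] := hsig; have [sLS2 dsLS2 _] := sLSd.
  (* [P] is defined by choice; that it lies in [L2] is read off from [v], whose weak divergence it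
     is. *)
  have [v2 P2 _] := vP; have [[_ gu2 _] _] := hu; have [_ [[_ guLS2 _] _]] := huLS.
  have s1 := L2_subspace mOm; have s2 := L2v_subspace mOm.
  have wd : Hdiv Om (v - sigLS) ((P : _ -> R^o) - (dsigLS : _ -> R^o)).
    rewrite addrC -scaleN1r [X in Hdiv _ _ X]addrC -[in X in Hdiv _ _ X]scaleN1r.
    exact: Hdiv_comb.
  have wR : RTN Om T p (v - sigLS).
    exact: subspaceB (RTN_subspace T mOm p) vR sLSR.
  have [_ w2 _] := wd; have w3 : L2v Om (v - sigLS) by exact: (subspaceB s2).
  rewrite /F !L2normE !L2normvE.
  apply: (galerkin_bound s1 s2 (ip_semi_inner mOm) (ipv_semi_inner mOm)
    (subspaceB s1 dsig2 dsLS2) (subspaceB s1 dsig2 P2) (subspaceB s2 sig2 sLS2)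
    (subspaceB s2 sig2 v2) (subspaceB s2 gu2 guLS2)).
  (* The test field [v - sigLS] is discrete and in H(div), so it is admissible in both equations;
     equating them eliminates [f]. *)
  have := eqLS2 _ _ (conj wR wd); rewrite -(eq2 _ _ wd).
  rewrite (_ : _ - _ - (_ - _) = (P : _ -> R^o) - (dsigLS : _ -> R^o)); last first.
    by rewrite opprB addrC addrA subrK.
  rewrite (_ : sig - sigLS - (sig - v) = v - sigLS); last first.
    by rewrite opprB addrC addrA subrK.
  rewrite (_ : sig - sigLS + (gu - guLS) = (sig \+ gu) - (sigLS \+ guLS)); last first.
    by rewrite addrACA -opprD.
  rewrite (semi_innerBl (ip_semi_inner mOm))// (semi_innerBl (ipv_semi_inner mOm))//.
  - lra.
  - exact: subspaceD s2 sig2 gu2.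
  - exact: subspaceD s2 sLS2 guLS2.
(* With no admissible field the infimum is [+oo]: the bound is trivial and attainment is vacuous. *)
have [A0|/set0P[v0 [v0R v0P]]] := eqVneq A set0.
  exists (ereal_inf [set (F v)%:E | v in A]).
    by split => //; rewrite A0 => -[].
  by rewrite A0 image_set0 ereal_inf0 addey// leey.
have [sig2 _ _] := hsig.
have [v Av vmin] := RTN_Hdiv_minimizer oOm bOm fT OmT sig2 v0R v0P.
exists (F v)%:E; last by rewrite -EFinD lee_fin; exact: bound.
split; last by exists v.
apply/eqP; rewrite eq_le; apply/andP; split.
  by apply/ereal_infP => _ [w [wR wP] <-]; rewrite lee_fin; exact: vmin.
by apply: ereal_inf_lbound; exists v.
Qed.
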